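(* For every real $q>0$ there exists a constant $\kappa_q>0$ (depending only on $q$) such that, for every non-negative function $u\in L^1(\mathbb{R})$ with $u\neq 0$, $$ \Bigl(\inf\{\xi>0 : \widehat{u}(\xi)=0 \text{ or } \widehat{u}(-\xi)=0\}\Bigr)^q\;\inf_{t_0\in\mathbb{R}}\int_{\mathbb{R}}|t-t_0|^q\,u(t)\,dt\;\geq\;\kappa_q\int_{\mathbb{R}}u(t)\,dt . $$
   Context: The Fourier transform of $u\in L^1(\mathbb{R})$ is $\widehat{u}(\xi)=\int_{\mathbb{R}}u(t)e^{-2i\pi\xi t}\,dt$ for $\xi\in\mathbb{R}$. Here $u\neq0$ means that $u$ is not almost everywhere zero. Quantities are taken in $[0,+\infty]$: the infimum of the empty set is $+\infty$ (so $(+\infty)^q=+\infty$), and the integral $\int_{\mathbb{R}}|t-t_0|^q u(t)\,dt$ may be $+\infty$. *)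

(* Defs.v *)
From HB Require Import structures.
From mathcomp Require Import all_boot all_order all_algebra.
From mathcomp Require Import complex.
From mathcomp Require Import all_classical all_reals all_analysis.

Set Implicit Arguments.
Unset Strict Implicit.
Unset Printing Implicit Defensive.

Import Order.TTheory GRing.Theory Num.Theory.
Import numFieldNormedType.Exports.

Local Open Scope classical_set_scope.
Local Open Scope ring_scope.
Local Open Scope complex_scope.

Definition cexp (R : realType) (z : R[i]) : R[i] :=
  (expR (complex.Re z))%:C * (cos (complex.Im z) +i* sin (complex.Im z)).

(* The library integrates real functions only; [Rintegral] is the intended value
   when the real and imaginary parts of [f] are integrable. *)
Definition cintegral (R : realType) (f : R -> R[i]) : R[i] :=
  (\int[@lebesgue_measure R]_(t in setT) complex.Re (f t))%R +i*
  (\int[@lebesgue_measure R]_(t in setT) complex.Im (f t))%R.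

Definition fourier (R : realType) (u : R -> R) (xi : R) : R[i] :=
  cintegral (fun t => (u t)%:C * cexp (- (2 * 'i%C * (pi * xi * t)%:C))).

(* An infimum in the extended reals: it is [+oo] when there is no such [xi]. *)
Definition first_zero (R : realType) (u : R -> R) : \bar R :=
  ereal_inf [set xi%:E | xi in
    [set xi : R | 0 < xi /\ (fourier u xi = 0 \/ fourier u (- xi) = 0)]].

Definition moment (R : realType) (q : R) (u : R -> R) (t0 : R) : \bar R :=
  (\int[@lebesgue_measure R]_(t in setT) (`|t - t0| `^ q * u t)%:E)%E.

Definition min_moment (R : realType) (q : R) (u : R -> R) : \bar R :=
  ereal_inf [set moment q u t0 | t0 in [set: R]].

(* Main.v *)
(* If [u^] vanishes at [xi] or [-xi], then
   [\int u(t) cos(2 pi xi (t - t0)) dt = 0] for every [t0]. Integrating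
   [cos y >= cos 1 - 2 |y|^q] against [u] at [y = 2 pi xi (t - t0)] gives
   [cos 1 * \int u <= 2 (2 pi xi)^q \int |t - t0|^q u(t) dt], hence the theorem
   with [kappa = cos 1 / (2 (2 pi)^q)] whenever both infima are positive and
   finite. In the degenerate cases the convention [0 * +oo = 0] is harmless
   since neither infimum is zero: [u^] is continuous with [u^(0) > 0], and by
   absolute continuity the mass of [u] cannot concentrate at a point. *)
Require Import Defs.
From mathcomp Require Import all_boot all_order all_algebra.
From mathcomp Require Import complex ring lra.
From mathcomp Require Import all_classical all_reals all_analysis.
From mathcomp Require Import measurable_realfun.

Import Order.TTheory GRing.Theory Num.Theory.
Import numFieldNormedType.Exports.

Local Open Scope classical_set_scope.
Local Open Scope ring_scope.
Local Open Scope ereal_scope.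

(** * Pointwise lower bound for the cosine *)

(** For [|y| <= 1] the bound comes from the cosine being even and decreasing on [[0, pi]], which
    contains 1. For [|y| > 1] the power is at least 1, so the left side is at most
    [cos 1 - 2 <= -1]. *)
Lemma cos_ge_cos1_powR {R : realType} {q : R} (y : R) : (0 < q)%R ->
  (cos 1 - 2 * `|y| `^ q <= cos y)%R.
Proof.
move=> q0; have [y1|y1] := lerP `|y| 1.
  have cosy : (cos 1 <= cos y)%R.
    have pi1 : (1 <= pi :> R)%R by have := @pi_ge2 R; lra.
    rewrite -(cos_norm y) leNgt ltr_cos ?in_itv/= -?leNgt//.
      by rewrite ler01.
    by rewrite normr_ge0 (le_trans y1).
  by have := powR_ge0 `|y| q; lra.
have : (1 <= `|y| `^ q)%R.
  have one_powR : (1 `^ q = 1 :> R)%R by rewrite powR1.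
  by rewrite -[leLHS]one_powR ge0_ler_powR ?nnegrE ?normr_ge0 ?ler01 ?ltW.
by have := cos_le1 (1 : R); have := cos_geN1 y; lra.
Qed.

Lemma kappa_gt0 {R : realType} (q : R) :
  (0 < cos 1 / (2 * (2 * pi) `^ q) :> R)%R.
Proof.
by rewrite divr_gt0 ?cos1_gt0// mulr_gt0// powR_gt0// mulr_gt0// pi_gt0.
Qed.

(** * Real and imaginary parts of the Fourier transform *)

Lemma integrable_mul_continuous {R : realType} (u h : R -> R) :
  (@lebesgue_measure R).-integrable setT (EFin \o u) ->
  continuous h -> (forall t, (`|h t| <= 1)%R) ->
  (@lebesgue_measure R).-integrable setT (EFin \o (fun t => u t * h t)%R).
Proof.
move=> iu ch h1; have -> : EFin \o (fun t => u t * h t)%R =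
    (EFin \o u) \* (EFin \o h) by apply/funext => t /=; rewrite EFinM.
apply: integrableMl => //; first exact: continuous_measurable_fun.
exists 1%R; split => // M M1 t _ /=.
by rewrite (le_trans (h1 t))// ltW.
Qed.

Lemma continuous_cos_scale {R : realType} (a : R) :
  continuous (fun t : R => cos (a * t))%R.
Proof.
by move=> t; apply: continuous_comp; [exact: mulrl_continuous|
                                      exact: continuous_cos].
Qed.

Lemma continuous_sin_scale {R : realType} (a : R) :
  continuous (fun t : R => sin (a * t))%R.
Proof.
by move=> t; apply: continuous_comp; [exact: mulrl_continuous|
                                      exact: continuous_sin].
Qed.

Lemma integrable_mul_cos {R : realType} {u : R -> R} (a : R) :
  (@lebesgue_measure R).-integrable setT (EFin \o u) ->
  (@lebesgue_measure R).-integrable setT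
    (EFin \o (fun t => u t * cos (a * t))%R).
Proof.
move=> iu; apply: integrable_mul_continuous => // [|t]; last exact: cos_max.
exact: continuous_cos_scale.
Qed.

Lemma integrable_mul_sin {R : realType} {u : R -> R} (a : R) :
  (@lebesgue_measure R).-integrable setT (EFin \o u) ->
  (@lebesgue_measure R).-integrable setT
    (EFin \o (fun t => u t * sin (a * t))%R).
Proof.
move=> iu; apply: integrable_mul_continuous => // [|t]; last exact: sin_max.
exact: continuous_sin_scale.
Qed.

Lemma fourierE {R : realType} (u : R -> R) (xi : R) :
  fourier u xi =
  Complex (\int[@lebesgue_measure R]_t (u t * cos (2 * pi * xi * t)))%R
          (\int[@lebesgue_measure R]_t (u t * - sin (2 * pi * xi * t)))%R.
Proof.
rewrite /fourier /cintegral.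
by congr Complex; apply: eq_Rintegral => t _ /=;
  rewrite !(mul0r, mul1r, mulr0, mulr1, subr0, addr0, add0r, oppr0, sub0r,
    expR0, cosN, sinN) !mulrA.
Qed.

(** Since [u] is real, its cosine integral is even in [xi] and its sine integral is odd, so a zero
    at [- xi] is also a zero at [xi]. *)
Lemma fourier_zeroP {R : realType} {u : R -> R} {xi : R} :
  (@lebesgue_measure R).-integrable setT (EFin \o u) ->
  fourier u xi = 0%R \/ fourier u (- xi) = 0%R ->
  (\int[@lebesgue_measure R]_t (u t * cos (2 * pi * xi * t)) = 0 /\
   \int[@lebesgue_measure R]_t (u t * sin (2 * pi * xi * t)) = 0)%R.
Proof.
move=> iu; rewrite !fourierE => -[] [Re0 Im0]; split.
- by [].
- apply: oppr_inj; rewrite oppr0 -[RHS]Im0 -mulN1r -RintegralZl//.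
    by apply: eq_Rintegral => t _; rewrite mulN1r mulrN.
  exact: integrable_mul_sin.
- by rewrite -[RHS]Re0; apply: eq_Rintegral => t _; rewrite mulrN mulNr cosN.
- rewrite -[RHS]Im0; apply: eq_Rintegral => t _.
  by rewrite (mulrN _ xi) mulNr sinN opprK.
Qed.

(** By the subtraction formula, the shifted cosine is a combination of [cos (a * t)] and
    [sin (a * t)] with coefficients independent of [t]. Translating [u] only multiplies its
    transform by a phase, so zeros are kept. *)
Lemma Rintegral_cos_shift_eq0 {R : realType} {u : R -> R} {xi : R} (t0 : R) :
  (@lebesgue_measure R).-integrable setT (EFin \o u) ->
  fourier u xi = 0%R \/ fourier u (- xi) = 0%R ->
  (\int[@lebesgue_measure R]_t (u t * cos (2 * pi * xi * (t - t0))) = 0)%R.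
Proof.
move=> iu /(fourier_zeroP iu)[cos0 sin0].
pose a := (2 * pi * xi : R)%R.
transitivity (\int[@lebesgue_measure R]_t
   (cos (a * t0) * (u t * cos (a * t)) + sin (a * t0) * (u t * sin (a * t))))%R.
  by apply: eq_Rintegral => t _; rewrite mulrBr cosB; ring.
have icos := integrable_mul_cos a iu; have isin := integrable_mul_sin a iu.
rewrite RintegralD//; last 2 first.
- by have := integrableZl measurableT (cos (a * t0)) icos; apply: eq_integrable.
- by have := integrableZl measurableT (sin (a * t0)) isin; apply: eq_integrable.
by rewrite !RintegralZl// cos0 sin0 !mulr0 addr0.
Qed.

(** * Moment bound at a single zero *)

Lemma measurable_moment_integrand {R : realType} (q t0 : R) {u : R -> R} :
  measurable_fun [set: R] u ->
  measurable_fun [set: R] (fun t => `|t - t0| `^ q * u t)%R.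
Proof.
move=> mu; apply: measurable_funM => //.
apply: (measurableT_comp (measurable_powR q)).
apply: measurableT_comp => //.
exact: measurable_funB.
Qed.

Lemma moment_ge0 {R : realType} (q : R) {u : R -> R} (t0 : R) :
  (forall t, (0 <= u t)%R) -> 0 <= moment q u t0.
Proof.
by move=> u0; apply: integral_ge0 => t _; rewrite lee_fin mulr_ge0// powR_ge0.
Qed.

Lemma moment_ge_at_zero {R : realType} {q : R} {u : R -> R} {xi : R} (t0 : R) :
  (0 < q)%R ->
  (@lebesgue_measure R).-integrable setT (EFin \o u) ->
  (forall t, (0 <= u t)%R) ->
  (0 < xi)%R -> fourier u xi = 0%R \/ fourier u (- xi) = 0%R ->
  (cos 1 / (2 * (2 * pi) `^ q))%:E *
    \int[@lebesgue_measure R]_(t in setT) (u t)%:E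
  <= (xi `^ q)%:E * moment q u t0.
Proof.
move=> q0 iu u0 xi0 fz.
have mom0 := moment_ge0 q t0 u0.
have [momfin|] := boolP (moment q u t0 \is a fin_num); last first.
  rewrite ge0_fin_numE// -leNgt leye_eq => /eqP ->.
  by rewrite gt0_muley ?leey// lte_fin powR_gt0.
have pi20 : (0 < 2 * pi :> R)%R by rewrite mulr_gt0// pi_gt0.
have cpos : (0 < (2 * pi) `^ q :> R)%R by exact: powR_gt0.
have imom : (@lebesgue_measure R).-integrable setT
    (EFin \o (fun t => `|t - t0| `^ q * u t)%R).
  apply/integrableP; split.
    apply/measurable_EFinP; apply: measurable_moment_integrand.
    by apply/measurable_EFinP; exact: measurable_int iu.
  move: momfin; rewrite ge0_fin_numE// /moment; apply: le_lt_trans.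
  rewrite le_eqVlt; apply/orP; left; apply/eqP; apply: eq_integral => t _.
  by rewrite /= ger0_norm// mulr_ge0// powR_ge0.
have icos : (@lebesgue_measure R).-integrable setT
    (EFin \o (fun t => u t * cos (2 * pi * xi * (t - t0)))%R).
  apply: integrable_mul_continuous => // t; last exact: cos_max.
  apply: continuous_comp; last exact: continuous_cos.
  apply: continuous_comp; last exact: mulrl_continuous.
  by apply: cvgB; [exact: cvg_id|exact: cvg_cst].
have key : (cos 1 * \int[@lebesgue_measure R]_t u t <=
    2 * (2 * pi * xi) `^ q *
    \int[@lebesgue_measure R]_t (`|t - t0| `^ q * u t))%R.
  (* The vanishing shifted cosine integral is subtracted from the left side; what remains is
     monotonicity of the integral for [u * (cos 1 - cos y) <= 2 * |y|^q * u]. *)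
  rewrite -[leLHS]subr0 -(Rintegral_cos_shift_eq0 t0 iu fz).
  have icu : (@lebesgue_measure R).-integrable setT
      (EFin \o (fun t => cos 1 * u t)%R).
    by have := integrableZl measurableT (cos 1) iu; apply: eq_integrable.
  rewrite -!RintegralZl// -RintegralB//; apply: le_Rintegral => //.
  - by have := integrableB measurableT icu icos; apply: eq_integrable.
  - have := integrableZl measurableT (2 * (2 * pi * xi) `^ q)%R imom.
    by apply: eq_integrable.
  - move=> t _.
    have := cos_ge_cos1_powR (2 * pi * xi * (t - t0)) q0.
    have axi0 : (0 < 2 * pi * xi)%R by exact: mulr_gt0.
    rewrite normrM (gtr0_norm axi0) (powRM q (ltW axi0) (normr_ge0 _)).
    move=> /(ler_wpM2r (u0 t)).
    set A := powR (2 * pi * xi) q; set B := powR _ q.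
    by nra.
have ufin : \int[@lebesgue_measure R]_(t in setT) (u t)%:E \is a fin_num.
  exact: integrable_fin_num iu.
rewrite -(fineK ufin) -(fineK momfin) -!EFinM lee_fin.
move: key; rewrite /Rintegral -/(moment q u t0).
rewrite (powRM q (ltW pi20) (ltW xi0)) => key.
by rewrite mulrAC ler_pdivrMr ?mulr_gt0//; lra.
Qed.

(** * Positivity of the two infima *)

(** The real part [F] of the transform suffices. It is continuous at 0 by domination by [|u|], and
    [F 0] is the mass of [u], so [F] stays positive on some ball of radius [e] and every zero is at
    least [e]. *)
Lemma first_zero_gt0 {R : realType} {u : R -> R} :
  (@lebesgue_measure R).-integrable setT (EFin \o u) ->
  (0 < \int[@lebesgue_measure R]_t u t)%R -> 0 < first_zero u.
Proof.
move=> iu m0.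
pose F (x : R) := (\int[@lebesgue_measure R]_t (u t * cos (2 * pi * x * t)))%R.
have F0 : F 0%R = (\int[@lebesgue_measure R]_t u t)%R.
  by apply: eq_Rintegral => t _; rewrite mulr0 mul0r cos0 mulr1.
have F_cont : {for 0%R, continuous F}.
  have : {in `](-1)%R, 1%R[%classic, continuous F}.
    apply: (@continuity_under_integral _ _ _ (@lebesgue_measure R)
      (fun x t => u t * cos (2 * pi * x * t))%R setT _ _ _ _ _
      (fun t => `|u t|%R)) => //.
    - by move=> x _; exact: integrable_mul_cos.
    - apply: aeW => t _ x _.
      apply: continuous_comp; last exact: mulrl_continuous.
      apply: continuous_comp; last exact: continuous_cos.
      by apply: cvgM; [exact: mulrl_continuous|exact: cvg_cst].
    - exact: integrable_norm.
    - move=> x _; apply: aeW => t _; rewrite normrM.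
      by rewrite -[leRHS]mulr1 ler_wpM2l// cos_max.
  by apply; rewrite inE/= in_itv/= ltrN10 ltr01.
have : \forall x \near 0%R, (0 < F x)%R.
  by apply: (cvgr_gt (F 0%R) F_cont); rewrite F0.
move=> /nbhs_ballP[e /= e0 eF].
apply: (@lt_le_trans _ _ e%:E); first by rewrite lte_fin.
apply/ereal_infP => _ [xi [xi0 fz] <-]; rewrite lee_fin leNgt.
apply/negP => xie.
have [Fxi _] := fourier_zeroP iu fz.
suff : (0 < F xi)%R by rewrite /F Fxi ltxx.
by apply: eF; rewrite /ball/= sub0r normrN gtr0_norm.
Qed.

(* Absolute continuity of [u dt] keeps half of the mass of [u] outside any
   interval of length [2 r], with [r] independent of its center. *)
Lemma min_moment_gt0 {R : realType} {q : R} {u : R -> R} :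
  (0 < q)%R ->
  (@lebesgue_measure R).-integrable setT (EFin \o u) ->
  (forall t, (0 <= u t)%R) ->
  (0 < \int[@lebesgue_measure R]_t u t)%R -> 0 < min_moment q u.
Proof.
move=> q0 iu u0 m0; set m := Rintegral _ _ _ in m0.
have [d [d0 dA]] := integral_normr_continuous iu (divr_gt0 m0 (ltr0Sn R 1)).
(* A ball of radius [r] has measure [d / 2 < d], so it carries less than [m / 2], whatever its
   center. Outside it the weight is at least [r]^ q[, whence the uniform bound]r [^ q * (m / 2)]. *)
pose r := (d / 4)%R; have r0 : (0 < r)%R by rewrite divr_gt0.
apply: (@lt_le_trans _ _ (r `^ q * (m / 2))%:E).
  by rewrite lte_fin mulr_gt0 ?powR_gt0// divr_gt0.
apply/ereal_infP => _ [t0 _ <-].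
pose A : set R := ball t0 r.
have mA : measurable A by exact: measurable_ball.
have mCA : measurable (~` A) by exact: measurableC.
have uA : (\int[@lebesgue_measure R]_(t in A) u t < m / 2)%R.
  have -> : (\int[@lebesgue_measure R]_(t in A) u t =
             \int[@lebesgue_measure R]_(t in A) `|u t|)%R.
    by apply: eq_Rintegral => t _; rewrite ger0_norm.
  apply: dA => //; rewrite [ltLHS](lebesgue_measure_ball t0 (ltW r0)).
  by rewrite lte_fin /r mulr2n; lra.
have iuC : (@lebesgue_measure R).-integrable (~` A) (EFin \o u).
  exact: integrableS iu.
have uCA : (m / 2 <= \int[@lebesgue_measure R]_(t in ~` A) u t)%R.
  have : m = (\int[@lebesgue_measure R]_(t in A) u t +
             \int[@lebesgue_measure R]_(t in ~` A) u t)%R.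
    rewrite -Rintegral_setU ?setUv//.
    by apply/disj_setPS => t [].
  by move: uA; lra.
have mmom : measurable_fun [set: R] (fun t => `|t - t0| `^ q * u t)%R.
  apply: measurable_moment_integrand.
  by apply/measurable_EFinP; exact: measurable_int iu.
apply: (@le_trans _ _
    (\int[@lebesgue_measure R]_(t in ~` A) (r `^ q * u t)%:E)).
  under eq_integral do rewrite EFinM.
  rewrite integralZl// -(fineK (integrable_fin_num _ iuC))//.
  by rewrite -EFinM lee_fin ler_wpM2l// powR_ge0.
apply: (@le_trans _ _
    (\int[@lebesgue_measure R]_(t in ~` A) (`|t - t0| `^ q * u t)%:E)).
  apply: ge0_le_integral => //.
  - by move=> t _; rewrite lee_fin mulr_ge0// powR_ge0.
  - apply/measurable_EFinP; apply: measurable_funM => //.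
    by apply/measurable_EFinP; exact: measurable_int iuC.
  - by apply/measurable_EFinP; exact: measurable_funTS.
  - move=> t /= tA; rewrite lee_fin ler_wpM2r//.
    rewrite ge0_ler_powR ?nnegrE ?normr_ge0 ?(ltW r0) ?(ltW q0)//.
    by rewrite leNgt distrC; apply/negP.
apply: ge0_subset_integral => //; first exact/measurable_EFinP.
by move=> t _; rewrite lee_fin mulr_ge0// powR_ge0.
Qed.

(** * Passage to the infima *)

Lemma uncertainty_nonneg {R : realType} {q : R} {u : R -> R} :
  (0 < q)%R ->
  (@lebesgue_measure R).-integrable setT (EFin \o u) ->
  (forall t, (0 <= u t)%R) ->
  (0 < \int[@lebesgue_measure R]_t u t)%R ->
  (cos 1 / (2 * (2 * pi) `^ q))%:E *
    \int[@lebesgue_measure R]_(t in setT) (u t)%:E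
    <= first_zero u `^ q * min_moment q u.
Proof.
move=> q0 iu u0 m0.
have Z0 := first_zero_gt0 iu m0; have M0 := min_moment_gt0 q0 iu u0 m0.
(* When no moment is finite, strict positivity of [first_zero u] excludes the product [0 * +oo]. *)
have [Moo|Mfin] := eqVneq (min_moment q u) +oo.
  by rewrite Moo gt0_muley ?poweR_gt0// leey.
have {Mfin} : min_moment q u \is a fin_num.
  by rewrite ge0_fin_numE ?ltW// ltey.
case E : (min_moment q u) M0 => [M| |] // M0 _; rewrite lte_fin in M0.
have := fun xi t0 => @moment_ge_at_zero R q u xi t0 q0 iu u0.
rewrite -(fineK (integrable_fin_num _ iu))// -/(Rintegral _ _ _).
have := kappa_gt0 q; set k := (cos 1 / _)%R => k0 zeroP.
rewrite -EFinM in zeroP *; set c := (k * _)%R in zeroP *.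
have c0 : (0 < c)%R by exact: mulr_gt0.
have cM : (0 < c / M)%R by exact: divr_gt0.
pose z := ((c / M) `^ q^-1)%R.
have zq : (z `^ q = c / M)%R by rewrite -powRrM mulVf ?gt_eqF// powRr1// ltW.
have zZ : z%:E <= first_zero u.
  apply/ereal_infP => _ [xi [xi0 fz] <-]; rewrite lee_fin.
  have xiq : (c <= xi `^ q * M)%R.
    rewrite -lee_fin [(_ * M)%:E]EFinM -E -ereal_inf_pZl ?powR_gt0//.
    by apply/ereal_infP => _ [_ [t0 _ <-] <-]; exact: zeroP.
  have : (z `^ q <= xi `^ q)%R by rewrite zq ler_pdivrMr.
  rewrite leNgt (leNgt z); apply: contra => xiz.
  by rewrite gt0_ltr_powR ?nnegrE ?(ltW xi0) ?powR_ge0.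
apply: (@le_trans _ _ ((z `^ q)%:E * M%:E)).
  by rewrite zq -EFinM lee_fin divfK// gt_eqF.
rewrite lee_wpmul2r ?lee_fin ?(ltW M0)// -poweR_EFin.
by rewrite gt0_ler_poweR ?(ltW q0)// in_itv/= ?leey ?andbT ?lee_fin ?powR_ge0
  ?(ltW Z0).
Qed.

(** * From non-negative almost everywhere to non-negative everywhere *)

Theorem theorem2p1 (R : realType) (q : R) (q_gt0 : (0 < q)%R) :
  exists2 kappa : R, (0 < kappa)%R &
    forall u : R -> R,
      (@lebesgue_measure R).-integrable setT (EFin \o u) ->
      {ae @lebesgue_measure R, forall t, (0 <= u t)%R} ->
      ~ {ae @lebesgue_measure R, forall t, u t = 0%R} ->
      kappa%:E * \int[@lebesgue_measure R]_(t in setT) (u t)%:E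
        <= first_zero u `^ q * min_moment q u.
Proof.
exists (cos 1 / (2 * (2 * pi) `^ q))%R.
  exact: kappa_gt0.
move=> u iu u_ge0 u_neq0.
have mu : measurable_fun [set: R] u.
  by apply/measurable_EFinP; exact: measurable_int iu.
(* [v] is non-negative everywhere and agrees with [u] almost everywhere, so both sides of the
   inequality are the same for [u] and [v]. *)
pose v t := `|u t|%R.
have mv : measurable_fun [set: R] v by exact: measurableT_comp.
have iv : (@lebesgue_measure R).-integrable setT (EFin \o v).
  exact: integrable_norm.
(* The weight [h] will be 1 for the mass, a power of the distance to [t0] for the moments, and a
   cosine or minus a sine for the transform. *)
have ae_uv (h : R -> R) : measurable_fun [set: R] h ->
    \int[@lebesgue_measure R]_(t in setT) (h t * u t)%:E =
    \int[@lebesgue_measure R]_(t in setT) (h t * v t)%:E.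
  move=> mh; apply: ae_eq_integral => //.
  - by apply/measurable_EFinP; exact: measurable_funM.
  - by apply/measurable_EFinP; exact: measurable_funM.
  - apply: filterS u_ge0.
      exact: (ae_filter_ringOfSetsType (@lebesgue_measure R)).
    by move=> t ut0 _; rewrite /v ger0_norm.
have int_uv : \int[@lebesgue_measure R]_(t in setT) (u t)%:E =
    \int[@lebesgue_measure R]_(t in setT) (v t)%:E.
  have := ae_uv (cst 1%R) (measurable_cst _).
  under eq_integral do rewrite mul1r.
  by under [RHS]eq_integral do rewrite mul1r.
have mom_uv t0 : moment q u t0 = moment q v t0.
  apply: (ae_uv (fun t => `|t - t0| `^ q)%R).
  have := @measurable_moment_integrand R q t0 (cst 1%R) (measurable_cst _).
  by under eq_fun do rewrite mulr1.
have min_uv : min_moment q u = min_moment q v.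
  by rewrite /min_moment; under eq_fun do rewrite mom_uv.
have fourier_uv xi : fourier u xi = fourier v xi.
  rewrite !fourierE; congr Complex; rewrite /Rintegral.
  - under eq_integral do rewrite mulrC; rewrite ae_uv.
      by under eq_integral do rewrite mulrC.
    by apply: continuous_measurable_fun; exact: continuous_cos_scale.
  - under eq_integral do rewrite mulrC; rewrite ae_uv.
      by under eq_integral do rewrite mulrC.
    apply: continuous_measurable_fun => t; apply: cvgN.
    exact: continuous_sin_scale.
have first_uv : first_zero u = first_zero v.
  by rewrite /first_zero (funext fourier_uv).
rewrite int_uv min_uv first_uv; apply: uncertainty_nonneg => //.
  by move=> t; exact: normr_ge0.
(* The mass of [v] is positive: a zero integral of [|u|] would force [u] to vanish almost
   everywhere. *)
rewrite lt_neqAle Rintegral_ge0 ?andbT; last by move=> t _; exact: normr_ge0.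
apply/eqP => int0; apply: u_neq0.
have : \int[@lebesgue_measure R]_(t in setT) `|(EFin \o u) t| = 0.
  rewrite -(fineK (integrable_fin_num measurableT iv)) -/(Rintegral _ _ _).
  by rewrite -int0.
move=> /(ae_eq_integral_abs _ measurableT (measurable_int _ iu)).
by apply: filterS => t /(_ I) [].
Qed.
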